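(* Let $f\colon[0,1]\to[0,1]$ be a continuous map with positive topological entropy. If the set of periodic points of $f$ is dense in $[0,1]$, then there exist $n\in\mathbb{N}$ and an $f^n$-invariant closed set $X\subset[0,1]$ such that $f^n|_X$ is topologically conjugate to the full shift dynamical system $(\Sigma_2,\sigma)$.
   Context: $\mathbb{N}$ denotes the positive integers and $f^n$ the $n$-fold composition of $f$. A point $x$ is periodic for $f$ if $f^k(x)=x$ for some $k\in\mathbb{N}$. A set $X$ is $f^n$-invariant if $f^n(X)\subset X$. $(\Sigma_2,\sigma)$ is the one-sided full shift on two symbols: $\Sigma_2=\{0,1\}^{\mathbb{N}}$ with the product topology (discrete topology on $\{0,1\}$), and $\sigma(w_1w_2w_3\cdots)=w_2w_3\cdots$. Two continuous maps $S\colon X\to X$ and $T\colon Y\to Y$ of compact metric spaces are topologically conjugate if there is a homeomorphism $\phi\colon X\to Y$ with $\phi\circ S=T\circ\phi$. Topological entropy is the usual one for continuous self-maps of compact metric spaces. *)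

(* Defs.v *)
From HB Require Import structures.
From mathcomp Require Import all_boot all_order all_algebra finmap.
From mathcomp Require Import all_classical all_reals all_analysis.

Set Implicit Arguments.
Unset Strict Implicit.
Unset Printing Implicit Defensive.

Import Order.TTheory GRing.Theory Num.Theory.
Import numFieldNormedType.Exports.

Local Open Scope classical_set_scope.
Local Open Scope ring_scope.

Definition unit_interval (R : realType) : set R := `[0, 1].
Arguments unit_interval : clear implicits.

Definition periodic_points (T : Type) (f : T -> T) : set T :=
  [set x | exists2 k, (0 < k)%N & iter k f x = x].

Definition invariant_set (T : Type) (f : T -> T) (X : set T) := f @` X `<=` X.

Section restriction.
Variables (T : Type) (f : T -> T) (X : set T) (fX : invariant_set f X).

Lemma restrict_self_subproof (x : X) : f (\val x) \in X.
Proof. by apply/mem_set/fX; exists (\val x) => //; exact: set_valP. Qed.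

Definition restrict_self (x : X) : X :=
  exist _ (f (\val x)) (restrict_self_subproof x).

End restriction.

(* Bowen's definition, stated through balls: [~ ball a e b] is the inequality
   [e <= d a b]. *)
Section entropy.
Variables (R : realType) (X : pseudoMetricType R) (T : X -> X).

Definition separated (n : nat) (e : R) (E : {fset X}) :=
  forall x y, x \in E -> y \in E -> x != y ->
    exists2 i, (i < n)%N & ~ ball (iter i T x) e (iter i T y).

Definition max_separated (n : nat) (e : R) : \bar R :=
  ereal_sup [set (#|` E|%:R)%:E | E in separated n e].

(* The growth rate is monotone in e, so the supremum over e > 0 is the limit
   as e tends to 0. *)
Definition topological_entropy : \bar R :=
  ereal_sup [set limn_esup (fun n => (n%:R^-1)%:E * lne (max_separated n e))%E
            | e in [set e : R | 0 < e]].

End entropy.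

(* [cantor_space] is the product topology on [nat -> bool] with [bool]
   discrete; the coordinate w_i of a sequence w_1 w_2 w_3 ... is [w i.-1]. *)
Definition full_shift (w : cantor_space) : cantor_space := fun i => w i.+1.

Definition homeomorphism (X Y : topologicalType) (phi : X -> Y) :=
  continuous phi /\
  exists psi : Y -> X, [/\ cancel phi psi, cancel psi phi & continuous psi].

Definition topologically_conjugate (X Y : topologicalType)
    (S : X -> X) (T : Y -> Y) :=
  exists2 phi : X -> Y, homeomorphism phi & phi \o S = T \o phi.

(* Main.v *)
Require Import Defs.
From mathcomp Require Import all_boot all_order all_algebra finmap.
From mathcomp Require Import all_classical all_reals all_analysis.
From mathcomp Require Import ring lra.
Import Order.TTheory GRing.Theory Num.Theory.
Import numFieldNormedType.Exports.
Local Open Scope classical_set_scope.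
Local Open Scope ring_scope.

(** The proof replaces the structure theory of positive-entropy interval maps
by three elementary facts about a continuous [f] whose periodic points are
dense.

Positive entropy is used only to know that [f \o f] is not the identity: the
orbits of an involution have two points, so its separated sets have bounded
size ([entropy_involution]).

If [f \o f] is not the identity, some iterate of [f] has a strict horseshoe,
that is, two disjoint segments each mapped over the hull of both.  The source
of horseshoes is [horseshoe_of_nonalternating]: a periodic orbit lying on both
sides of a fixed point [b], but not jumping across [b] at every step, gives
covering loops of two consecutive lengths, and these can be synchronised.
Suppose now that there is no horseshoe.  Then a periodic point that stays once
on its side of a fixed point stays there forever, and density of the periodic
points turns this into rigidity for [G = f \o f]: near a fixed point followed
by a region where [G] moves points up, a periodic point would climb forever
([no_climb]).  Hence the fixed points of [G] form an interval, and if [G] is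
not the identity this interval is a point [b] ([unique_fixed]) across which
all other periodic points jump ([alternating]).  But [b] is also fixed by [f],
and a periodic orbit of [f] either jumps across [b] at every step or never
does; in both cases [f \o f] does not jump, a contradiction
([horseshoe_of_dense_periodic]).

Finally, let [G] be an iterate with a strict horseshoe.  Nested cylinders
chosen with [G] mapping each one exactly onto the next give, for each 0-1
sequence [w], a nonempty segment [fiber w] of points with itinerary [w], and
[G @` fiber w = fiber (shift w)].  A nondegenerate fiber contains a periodic
point, so its itinerary is periodic.  If [fiber w] were nondegenerate, so
would be the two fibers mapped onto it, those of [0w] and [1w]; but [0w] and
[1w] cannot both be periodic ([fiber_inj]).  So every fiber is a point, and
[w |-> fiber w] embeds the full shift in [G]. *)

(** * Involutions have zero entropy *)

Section zero_entropy.
Context {R : realType}.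
Local Notation I := (unit_interval R).

Lemma unit_val01 (x : I) : 0 <= \val x <= 1.
Proof. by have := set_valP x; rewrite /unit_interval /= in_itv. Qed.

Lemma card_le_cells {T : choiceType} {C : finType} (E : {fset T}) (h : T -> C) :
  {in E &, injective h} -> (#|` E| <= #|C|)%N.
Proof.
move=> h_inj; rewrite -(size_map h) -(card_uniqP _); first exact: max_card.
by rewrite map_inj_in_uniq.
Qed.

Lemma truncn_cell (x y : R) N : 0 <= x -> 0 <= y ->
  Num.truncn (x * N%:R) = Num.truncn (y * N%:R) -> `|x - y| * N%:R < 1.
Proof.
move=> x0 y0 xy; have N0 : 0 <= N%:R :> R := ler0n _ _.
have := truncn_itv (mulr_ge0 x0 N0); have := truncn_itv (mulr_ge0 y0 N0).
rewrite xy -natr1 -[X in _ * X < 1](ger0_norm N0) -normrM mulrBl ltr_norml; lra.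
Qed.

(** Cutting the unit interval into cells of length less than [e], a
separated set has at most one point for each pair of cells of [x] and [f x],
because these two points are the whole orbit of [x]. *)
Lemma separated_card_le (f : I -> I) n e N (E : {fset I}) :
  (forall x, f (f x) = x) -> e^-1 < N%:R -> 0 < e ->
  Defs.separated f n e E -> (#|` E| <= N.+1 * N.+1)%N.
Proof.
move=> ff eN e0 sepE.
pose cell (x : I) : 'I_N.+1 := inord (Num.truncn (\val x * N%:R)).
have I01 (x : I) : 0 <= \val x <= 1 := unit_val01 x.
have cell_lt (x : I) : (Num.truncn (\val x * N%:R) < N.+1)%N.
  have N0 : 0 <= N%:R :> R := ler0n _ _.
  rewrite truncn_lt_nat; first by rewrite -natr1; have := I01 x; nra.
  by rewrite mulr_ge0 //; have := I01 x; lra.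
have cell_ball x y : cell x = cell y -> ball x e y.
  move=> /(congr1 val); rewrite /= !inordK //.
  move=> /truncn_cell xy.
  change (ball (\val x) e (\val y)); rewrite /ball /=.
  have {}xy : `|\val x - \val y| * N%:R < 1.
    by apply: xy; have := I01 x; have := I01 y; lra.
  have N0 : 0 < N%:R :> R by apply: lt_trans eN; rewrite invr_gt0.
  rewrite -(ltr_pM2r N0); apply: lt_trans xy _.
  by rewrite -[ltLHS](mulfV (lt0r_neq0 e0)) ltr_pM2l.
have := @card_le_cells _ ('I_N.+1 * 'I_N.+1)%type E
  (fun x => (cell x, cell (f x))).
rewrite card_prod !card_ord; apply => x y xE yE [cxy cfxy].
apply/eqP/negPn/negP => xy; have [i _] := sepE x y xE yE xy; apply.
have iter_f z : iter i f z = if odd i then f z else z.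
  by elim: i => //= i ->; case: (odd i); rewrite /= ?ff.
by rewrite !iter_f; case: (odd i); exact: cell_ball.
Qed.

(** The bound on separated sets does not depend on [n], so dividing its
logarithm by [n] kills the growth rate. *)
Lemma entropy_involution (f : I -> I) : (forall x, f (f x) = x) ->
  (topological_entropy f <= 0)%E.
Proof.
move=> ff; apply: ge_ereal_sup => _ [e /= e0 <-].
(* cells of length [N^-1 < e] *)
pose N := (Num.truncn e^-1).+1; pose C : R := (N.+1 * N.+1)%:R.
have eN : e^-1 < N%:R by apply: truncnS_gt.
have C1 : 1 <= C by rewrite ler1n.
have lnC : 0 <= ln C by exact: ln_ge0.
have max_le n : (max_separated f n e <= C%:E)%E.
  apply: ge_ereal_sup => _ [E sepE <-]; rewrite lee_fin ler_nat.
  exact: separated_card_le ff eN e0 sepE.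
have lne_le n : (lne (max_separated f n e) <= (ln C)%:E)%E.
  have [m0|m0] := leP (max_separated f n e) 0%E.
    by rewrite le0_lneNy // leNye.
  rewrite -lne_EFin; last by lra.
  have mem_itv (y : \bar R) : (0 <= y)%E -> y \in `[0%E, +oo%E].
    by move=> y0; rewrite in_itv /= y0 leey.
  rewrite lee_lne ?max_le //; apply: mem_itv; first exact: ltW.
  by rewrite lee_fin; lra.
apply/lee_addgt0Pr => d d0; rewrite add0e.
pose n0 := (Num.truncn (ln C / d)).+1.
have n0_gt : ln C / d < n0%:R by apply: truncnS_gt.
apply: le_trans (ereal_inf_lbound _) _.
  by exists [set n | (n0 <= n)%N] => //; exists n0.
apply: ge_ereal_sup => _ [n /= n0n <-].
have n_gt0 : 0 < n%:R :> R by rewrite ltr0n (leq_trans _ n0n).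
apply: (@le_trans _ _ ((n%:R^-1)%:E * (ln C)%:E)%E).
  by apply: lee_wpmul2l; rewrite ?lne_le // lee_fin invr_ge0 ltW.
rewrite -EFinM lee_fin mulrC ler_pdivrMr // mulrC -ler_pdivrMr //.
by apply: (le_trans (ltW n0_gt)); rewrite ler_nat.
Qed.

End zero_entropy.

(** * Horseshoes from periodic orbits that do not alternate *)

Lemma iter_continuous {T : topologicalType} {F : T -> T} n :
  continuous F -> continuous (iter n F).
Proof.
move=> Fc; elim: n => [|n IHn] x; first exact: cvg_id.
exact: (@continuous_comp _ _ _ (iter n F) F x (IHn x) (Fc _)).
Qed.

Lemma iter_periodic {T : Type} {F : T -> T} {m x} k :
  iter m F x = x -> iter (k * m) F x = x.
Proof. by move=> Fx; rewrite iterM; elim: k => //= k ->. Qed.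

Section covering.
Context {R : realType}.
Implicit Types (F G : R -> R) (b x y z : R).

Lemma mul_lt0_same_sign {x y z} : 0 < x * y -> x * z < 0 -> y * z < 0.
Proof.
have [x_lt0|x_gt0|->] := ltgtP x 0; last by rewrite mul0r ltxx.
  by rewrite nmulr_rgt0 // nmulr_rlt0 // => *; rewrite nmulr_rlt0.
by rewrite pmulr_rgt0 // pmulr_rlt0 // => *; rewrite pmulr_rlt0.
Qed.

Lemma mul_gt0_opp_sign {x y z} : x * y < 0 -> x * z < 0 -> 0 < y * z.
Proof.
have [x_lt0|x_gt0|->] := ltgtP x 0; last by rewrite mul0r ltxx.
  by rewrite !nmulr_rlt0 // => *; rewrite pmulr_rgt0.
by rewrite !pmulr_rlt0 // => *; rewrite nmulr_rgt0.
Qed.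

(** The segment with ends [x] and [y] in either order, so that the two sides
of a fixed point can be treated alike. *)
Definition seg x y : set R := [set t | (x <= t <= y) || (y <= t <= x)].

Lemma seg_image F x y : continuous F -> seg (F x) (F y) `<=` F @` seg x y.
Proof.
move=> Fc t; wlog xy : x y / x <= y.
  move=> H; have [|/ltW yx] := leP x y; first exact: H.
  move=> Ft; have [|u] := H y x yx; rewrite /seg /= orbC // => *.
  by exists u.
move=> Ft; have [||u] := @IVT _ F x y t xy.
- by apply: continuous_subspaceT => u; exact: Fc.
- rewrite ge_min le_max; move: Ft; rewrite /seg /=.
  by case/orP => /andP[-> ->]; rewrite ?orbT.
by rewrite in_itv /= => xuy <-; exists u => //; rewrite /seg /= xuy.
Qed.

Definition horseshoe G := exists a0 b0 a1 b1, [/\ a0 <= b0, b0 < a1, a1 <= b1,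
  `[a0, b1] `<=` G @` `[a0, b0] & `[a0, b1] `<=` G @` `[a1, b1]].

Lemma seg_minmax x y : seg x y `<=` `[Num.min x y, Num.max x y].
Proof.
by move=> t; rewrite /seg /= in_itv /= ge_min le_max => /orP[]/andP[-> ->];
  rewrite ?orbT.
Qed.

(** The points [s1], [t1] differ from the fixed point [b], so the segment
between them misses [b] and still maps over [seg l r]; the same holds for [s2],
[t2] on the other side.  Using these segments instead of [seg b l] and
[seg b r] is what makes the horseshoe strict. *)
Lemma horseshoe_of_crossing G b l r s1 t1 s2 t2 : continuous G -> G b = b ->
  (l - b) * (r - b) < 0 ->
  seg b l s1 -> seg b l t1 -> seg b r s2 -> seg b r t2 ->
  G s1 = l -> G t1 = r -> G s2 = l -> G t2 = r -> horseshoe G.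
Proof.
move=> Gc Gb; wlog lr : l r s1 t1 s2 t2 / l < r.
  move=> H lbr S1 T1 S2 T2 G1 G2 G3 G4; have [rl|rl|rl] := ltgtP l r.
  - exact: (H l r s1 t1 s2 t2).
  - by apply: (H r l t2 s2 t1 s1) => //; rewrite mulrC.
  - by move: lbr; rewrite rl -expr2 ltNge sqr_ge0.
move=> lbr; have {lbr}[lb br] : l < b /\ b < r by split; nra.
rewrite /seg /= => S1 T1 S2 T2 G1 G2 G3 G4.
have [s1b t1b] : s1 != b /\ t1 != b.
  by split; apply/eqP => e; move: G1 G2; rewrite e Gb; lra.
have [s2b t2b] : s2 != b /\ t2 != b.
  by split; apply/eqP => e; move: G3 G4; rewrite e Gb; lra.
have {S1 s1b}S1 : l <= s1 < b by move: s1b; rewrite neq_lt; lra.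
have {T1 t1b}T1 : l <= t1 < b by move: t1b; rewrite neq_lt; lra.
have {S2 s2b}S2 : b < s2 <= r by move: s2b; rewrite neq_lt; lra.
have {T2 t2b}T2 : b < t2 <= r by move: t2b; rewrite neq_lt; lra.
have sub x y : l <= x <= r -> l <= y <= r -> `[x, y] `<=` seg l r.
  by move=> ? ? t /=; rewrite in_itv /= /seg /= => ?; lra.
have cover s t : G s = l -> G t = r ->
    seg l r `<=` G @` `[Num.min s t, Num.max s t].
  move=> <- <-; apply: (subset_trans (seg_image _ _ _ Gc)).
  exact/image_subset/seg_minmax.
exists (Num.min s1 t1), (Num.max s1 t1), (Num.min s2 t2), (Num.max s2 t2).
have D : `[Num.min s1 t1, Num.max s2 t2] `<=` seg l r.
  apply: sub; rewrite /Num.max /Num.min; do 2?[case: ifP => _]; lra.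
split.
- by rewrite ge_min le_max lexx.
- by rewrite gt_max !lt_min; lra.
- by rewrite ge_min le_max lexx.
- exact: subset_trans D (cover _ _ G1 G2).
- exact: subset_trans D (cover _ _ G3 G4).
Qed.

(** All segments used have the fixed point [b] as an end; hence covering is a
relation between their other ends, and [covers_iter] makes every orbit a
path. *)
Definition covers F b x y n := seg b y `<=` iter n F @` seg b x.

Lemma covers_trans {F b x y z n k} :
  covers F b x y n -> covers F b y z k -> covers F b x z (k + n).
Proof.
by move=> xy yz t /yz[u /xy[v sv <-] <-]; exists v => //; rewrite iterD.
Qed.

Lemma covers_seg {F b x y} : seg b x y -> covers F b x y 0.
Proof.
by rewrite /seg /= => xy t; rewrite /seg /= => ?; exists t => //=; lra.
Qed.

Lemma covers_iter {F b} x n : continuous F -> F b = b ->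
  covers F b x (iter n F x) n.
Proof.
move=> Fc Fb; have Fnb : iter n F b = b by elim: n => //= n ->.
by rewrite /covers -{1}Fnb; exact: seg_image (iter_continuous n Fc).
Qed.

Lemma covers_mul {F b x n} k : covers F b x x n -> covers F b x x (k * n).
Proof.
move=> xx; elim: k => [|k IHk]; first by rewrite mul0n; move=> t ?; exists t.
by rewrite mulSn; exact: covers_trans IHk xx.
Qed.

(** Loops at [l] of the coprime lengths [i] and [i.+1] allow the passages
from [l] to [l] and from [l] to [r] to take the same time [s * i.+1]: either
[s] loops of length [i.+1], or [s] loops of length [i] followed by a passage of
length [s].  Going first from [r] to [l] gives the same for [r]. *)
Lemma horseshoe_of_covers F b l r i s s' : continuous F -> F b = b ->
  (l - b) * (r - b) < 0 -> covers F b l l i -> covers F b l l i.+1 ->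
  covers F b l r s -> covers F b r l s' ->
  exists2 n, (0 < n)%N & horseshoe (iter n F).
Proof.
move=> Fc Fb lbr lli lli' lrs rls.
(* [r] lies across [b], hence not on [seg b l] *)
have s_gt0 : (0 < s)%N.
  case: s lrs => // /(_ r); rewrite /seg /= => -[|t]; first lra.
  by move=> + tr; rewrite {}tr; nra.
pose N := (s * i.+1)%N.
have llN : covers F b l l N by exact: covers_mul.
have lrN : covers F b l r N.
  by rewrite /N mulnS; exact: covers_trans (covers_mul s lli) lrs.
pose p := (N + s')%N.
have rlp : covers F b r l p by exact: covers_trans rls llN.
have rrp : covers F b r r p by exact: covers_trans rls lrN.
have p_gt0 : (0 < p)%N by rewrite addn_gt0 muln_gt0 s_gt0.
have llM : covers F b l l (N * p) by rewrite mulnC; exact: covers_mul.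
have lrM : covers F b l r (N * p).
  rewrite -(prednK p_gt0) mulnS mulnC.
  exact: covers_trans (covers_mul _ llN) lrN.
have N_gt0 : (0 < N)%N by rewrite muln_gt0 s_gt0.
have rrM : covers F b r r (N * p) by exact: covers_mul.
have rlM : covers F b r l (N * p).
  rewrite -(prednK N_gt0) mulSn.
  exact: covers_trans (covers_mul _ rrp) rlp.
exists (N * p)%N; first by rewrite muln_gt0 N_gt0.
have xx x : seg b x x by rewrite /seg /=; lra.
have [s1 S1 G1] := llM _ (xx l); have [t1 T1 G2] := lrM _ (xx r).
have [s2 S2 G3] := rlM _ (xx l); have [t2 T2 G4] := rrM _ (xx r).
apply: (horseshoe_of_crossing _ b l r s1 t1 s2 t2) => //.
  exact: iter_continuous.
by elim: (N * p)%N => //= n ->.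
Qed.

(** Two consecutive points of the orbit on the same side of [b] are reached
from each other by covering, through the periodicity in one direction and by
inclusion in the other; this yields loops of lengths differing by one. *)
Lemma horseshoe_of_nonalternating F b z s : continuous F -> F b = b ->
  periodic_points F z -> 0 < (z - b) * (F z - b) ->
  (z - b) * (iter s F z - b) < 0 ->
  exists2 n, (0 < n)%N & horseshoe (iter n F).
Proof.
move=> Fc Fb [m m_gt0 Fz] same opp; set r := iter s F z.
have zr : covers F b z r s by exact: covers_iter.
have [k rz] : exists k, covers F b r z k.
  exists (s * m - s)%N; rewrite -[X in covers _ _ _ X](iter_periodic s Fz).
  rewrite -[X in iter X F](@subnK s); last by rewrite leq_pmulr.
  by rewrite iterD; exact: covers_iter.
have [zF|Fz'] : seg b z (F z) \/ seg b (F z) z by rewrite /seg /=; nra.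
- have Fzz : covers F b (F z) z m.-1.
    by rewrite -{2}Fz -(prednK m_gt0) iterSr; exact: covers_iter.
  have zFz := @covers_seg F _ _ _ zF.
  apply: (@horseshoe_of_covers F b (F z) r m.-1 (s + m.-1) (0 + k)) => //.
  + exact: mul_lt0_same_sign same opp.
  + exact: covers_trans Fzz zFz.
  + rewrite prednK // -[X in covers _ _ _ X](_ : iter m F (F z) = F z).
      exact: covers_iter.
    by rewrite -iterSr iterS Fz.
  + exact: covers_trans Fzz zr.
  + exact: covers_trans rz zFz.
- apply: (@horseshoe_of_covers F b z r 0 s k) => //.
    by apply: covers_seg; rewrite /seg /=; lra.
  exact: covers_trans (covers_iter z 1 Fc Fb) (covers_seg Fz').
Qed.

End covering.

(** * Dense periodic points force a horseshoe *)

Section dense_periodic.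
Context {R : realType}.
Implicit Types (F G : R -> R) (b c p w x y z : R).

Lemma within_id (A : set R) : {within A, continuous id}.
Proof. by apply: continuous_subspaceT => u; exact: cvg_id. Qed.

(** The orbit does not move after time [s], and it returns to [x] later. *)
Lemma periodic_landing {T : Type} {F : T -> T} {x : T} s :
  periodic_points F x ->
  F (iter s F x) = iter s F x -> iter s F x = x.
Proof.
move=> [m m0 Fx] Fs.
have Fk k : iter k F (iter s F x) = iter s F x by elim: k => //= k ->.
by rewrite -(Fk (s * m - s)%N) -iterD subnK ?leq_pmulr ?iter_periodic.
Qed.

Lemma compact_sublevel G c w : continuous G ->
  compact [set y | c <= y <= w /\ G y <= y].
Proof.
move=> Gc; have D : closed [set y | G y <= y].
  have -> : [set y | G y <= y] = (fun y => y - G y) @^-1` [set t | 0 <= t].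
    by apply/seteqP; split => y /=; rewrite subr_ge0.
  apply: closed_comp; last exact: closed_ge.
  by move=> y _; apply: cvgB; [exact: cvg_id | exact: Gc].
have -> : [set y | c <= y <= w /\ G y <= y] = `[c, w] `&` [set y | G y <= y].
  by apply/seteqP; split => y /=; rewrite in_itv.
by apply: compact_closedI D; exact: segment_compact.
Qed.

Lemma fixed_between G x y : continuous G -> x <= y ->
  (x <= G x /\ G y <= y) \/ (G x <= x /\ y <= G y) ->
  exists2 b, x <= b <= y & G b = b.
Proof.
move=> Gc xy H; have [||u] := @IVT _ (fun t => G t - t) x y 0 xy.
- apply: continuous_subspaceT => u.
  by apply: cvgB; [exact: Gc | exact: cvg_id].
- by rewrite ge_min le_max; case: H => ?; lra.
- by rewrite in_itv /= => xuy /eqP; rewrite subr_eq0 => /eqP ?; exists u.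
Qed.

Lemma first_fixed {G w b} : continuous G -> w < G w -> w <= b -> G b <= b ->
  exists b', [/\ w < b' <= b, G b' = b' & forall y, w <= y < b' -> y < G y].
Proof.
move=> Gc wG wb Gb; pose A := [set y | w <= y <= b /\ G y <= y].
have A0 : A !=set0 by exists b; split => //; lra.
have [b' /set_mem[wb' Gb'] b'min] := @compact_EVT_min _ _ id A A0
  (compact_sublevel G w b Gc) (within_id A).
have wb'' : w < b' by rewrite lt_neqAle; apply/andP; split;
  [apply/eqP => e; move: Gb'; rewrite -e; lra | lra].
have Ab' y : w <= y < b' -> y < G y.
  move=> wy; rewrite ltNge; apply/negP => Gy.
  by have := b'min y; rewrite inE => /(_ (conj _ Gy)) /=; lra.
exists b'; split => //; first lra.
have [||c c1 Gc'] := @fixed_between G w b' Gc; [lra|by left; lra|].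
have [?|?] : c < b' \/ c = b' by lra.
  by have := Ab' c; rewrite Gc'; lra.
by subst c.
Qed.

Lemma last_fixed {G w c} : continuous G -> w < G w -> c <= w -> G c <= c ->
  exists c', [/\ c <= c' < w, G c' = c' & forall y, c' < y <= w -> y < G y].
Proof.
move=> Gc wG cw Gcc; pose A := [set y | c <= y <= w /\ G y <= y].
have A0 : A !=set0 by exists c; split => //; lra.
have [c' /set_mem[cw' Gc'] c'max] := @compact_EVT_max _ _ id A A0
  (compact_sublevel G c w Gc) (within_id A).
have cw'' : c' < w by rewrite lt_neqAle; apply/andP; split;
  [apply/eqP => e; move: Gc'; rewrite e; lra | lra].
have Ac' y : c' < y <= w -> y < G y.
  move=> wy; rewrite ltNge; apply/negP => Gy.
  by have := c'max y; rewrite inE => /(_ (conj _ Gy)) /=; lra.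
exists c'; split => //; first lra.
have [||b b1 Gb] := @fixed_between G c' w Gc; [lra|by right; lra|].
have [?|?] : c' < b \/ c' = b by lra.
  by have := Ac' b; rewrite Gb; lra.
by subst b.
Qed.

(** What the absence of horseshoes says about periodic orbits, by
[horseshoe_of_nonalternating].  Unlike that absence, it is stated in terms of
orbits only and is thus easily carried through [mirror]. *)
Definition one_sided F := forall b z s, F b = b -> periodic_points F z ->
  0 < (z - b) * (F z - b) -> 0 <= (z - b) * (iter s F z - b).

Definition dense_in_unit (P : set R) :=
  forall u v, 0 <= u -> u < v -> v <= 1 -> exists2 x, u < x < v & P x.

Record tame G : Prop := Tame {
  tame_continuous : continuous G;
  tame_unit : forall x, 0 <= G x <= 1;
  tame_dense : dense_in_unit (periodic_points G);
  tame_one_sided : one_sided G }.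

(** Conjugation by the reflection of the unit interval, which exchanges
climbing and descending. *)
Definition mirror G x := 1 - G (1 - x).

Lemma mirrorE G x : mirror G (1 - x) = 1 - G x.
Proof. by rewrite /mirror subKr. Qed.

Lemma iter_mirror G n x : iter n (mirror G) x = 1 - iter n G (1 - x).
Proof.
by elim: n => [|n IHn] /=; [ring | rewrite IHn /mirror; congr (1 - G _); ring].
Qed.

Lemma periodic_mirror G x :
  periodic_points (mirror G) x <-> periodic_points G (1 - x).
Proof.
by split=> -[m m0 Gx]; exists m => //; move: Gx; rewrite ?iter_mirror; lra.
Qed.

Lemma tame_mirror G : tame G -> tame (mirror G).
Proof.
case=> Gc G01 Gd Gs; split.
- move=> x; apply: cvgB; first exact: cvg_cst.
  apply: (@continuous_comp _ _ _ (fun x => 1 - x) G x _ (Gc _)).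
  by apply: cvgB; [exact: cvg_cst | exact: cvg_id].
- by move=> x; have := G01 (1 - x); rewrite /mirror; lra.
- move=> u v u0 uv v1; have [|||x xuv Px] := Gd (1 - v) (1 - u); try lra.
  by exists (1 - x); [lra | apply/periodic_mirror; rewrite opprB addrC subrK].
- move=> b z s Gb /periodic_mirror Pz; have := Gs (1 - b) (1 - z) s _ Pz.
  rewrite iter_mirror /mirror in Gb *.
  have -> : (1 - z - (1 - b)) * (G (1 - z) - (1 - b)) =
    (z - b) * (1 - G (1 - z) - b) by ring.
  have -> : (1 - z - (1 - b)) * (iter s G (1 - z) - (1 - b)) =
    (z - b) * (1 - iter s G (1 - z) - b) by ring.
  by apply; lra.
Qed.

(** By one-sidedness the orbit of [x] stays below [b], where it increases
strictly, which a periodic orbit cannot do. *)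
Lemma no_climb G b x : tame G -> G b = b -> periodic_points G x -> x < b ->
  (forall y, x <= y < b -> y < G y) -> G x < b -> False.
Proof.
move=> [_ _ _ Gs] Gb Px xb up Gxb.
have below s : iter s G x <= b.
  by have := Gs b x s Gb Px; have := up x; nra.
have notb s : iter s G x != b.
  apply/eqP => e; have := periodic_landing s Px.
  by rewrite e => /(_ Gb); lra.
have climb s : x < iter s.+1 G x.
  elim: s => [|s IHs]; first by apply: up; lra.
  rewrite iterS; apply: (lt_trans IHs); apply: up.
  by rewrite (ltW IHs) lt_neqAle notb below.
by case: Px => m m0 Gx; have := climb m.-1; rewrite prednK // Gx ltxx.
Qed.

Lemma close_periodic_right G c w e : tame G -> 0 <= c -> c < w -> w <= 1 ->
  0 < e -> exists x, [/\ c < x < w, periodic_points G x & `|G c - G x| < e].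
Proof.
move=> [Gc _ Gd _] c0 cw w1 e0.
have /nbhs_ballP[d /= d0 near] : \forall x \near c, `|G c - G x| < e.
  by have /cvgrPdist_lt := Gc c; exact.
have [|||x xc Px] := Gd c (Num.min w (c + d)) => //.
- by rewrite lt_min cw ltrDl.
- by rewrite ge_min w1.
move: xc; rewrite lt_min => xc; exists x; split => //; first lra.
by apply: near; rewrite /ball /= distrC ger0_norm; lra.
Qed.

Lemma close_periodic_left G w b e : tame G -> 0 <= w -> w < b -> b <= 1 ->
  0 < e -> exists x, [/\ w < x < b, periodic_points G x & `|G b - G x| < e].
Proof.
move=> /tame_mirror tG w0 wb b1 e0.
have [|||x [xb /periodic_mirror Px Gx]] :=
  close_periodic_right _ (1 - b) (1 - w) e tG _ _ _ e0; try lra.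
exists (1 - x); split => //; first lra.
move: Gx; rewrite /mirror (_ : 1 - (1 - b) = b); last by ring.
by rewrite distrC (_ : 1 - _ - _ = G b - G (1 - x)) //; ring.
Qed.

(** Just above the last fixed point [c'] before [w] there are periodic points
whose images have not yet passed the first fixed point [b'] after [w]; such a
point contradicts [no_climb]. *)
Lemma fixed_interval_up G c w b : tame G -> 0 <= c -> c < w -> w < b ->
  b <= 1 -> G c = c -> G b = b -> w < G w -> False.
Proof.
move=> tG c0 cw wb b1 Gcc Gb wG; have Gc := tame_continuous _ tG.
have [||c' [cw' Gc' cup]] := @last_fixed G w c Gc wG; [lra|lra|].
have [||b' [wb' Gb' bup]] := @first_fixed G w b Gc wG; [lra|lra|].
have [||||x [xc Px]] := close_periodic_right G c' w (b' - c') tG; try lra.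
rewrite Gc' distrC => /ltr_normlW Gx.
apply: (no_climb G b' x) => //; try lra.
by move=> y yx; have [|] := leP y w => ?; [apply: cup|apply: bup]; lra.
Qed.

Lemma fixed_convex G c w b : tame G -> c < w < b ->
  G c = c -> G b = b -> G w = w.
Proof.
move=> tG cwb Gc Gb; have := tame_unit _ tG c; have := tame_unit _ tG b.
rewrite Gc Gb => b01 c01; have [wG|wG|] := ltgtP (G w) w; last by [].
- have := @fixed_interval_up (mirror G) (1 - b) (1 - w) (1 - c)
    (tame_mirror _ tG).
  by rewrite !mirrorE Gc Gb => H; exfalso; apply: H; lra.
- by exfalso; apply: (@fixed_interval_up G c w b) => //; lra.
Qed.

(** A fixed point on the other side of [w] is excluded by [fixed_convex].  A
fixed point [c] beyond the first one [b] would make all of [seg b c] fixed;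
then a periodic point just below [b] is either sent below [b], against
[no_climb], or sent to a fixed point, against periodicity. *)
Lemma unique_fixed_up G w : tame G -> 0 <= w <= 1 -> w < G w ->
  exists2 b, G b = b & forall c, G c = c -> c = b.
Proof.
move=> tG w01 wG; have Gc := tame_continuous _ tG.
have [||b [wb Gb bup]] := @first_fixed G w 1 Gc wG; first lra.
  by have := tame_unit _ tG 1; lra.
exists b => // c Gcc; have := tame_unit _ tG c; rewrite Gcc => c01.
have [cb|bc|//] := ltgtP c b.
  have [cw|wc] := ltP c w.
    by have := fixed_convex G c w b tG _ Gcc Gb; lra.
  by have := bup c; lra.
have [||||x [xb Px]] := close_periodic_left G w b (c - b) tG; try lra.
rewrite Gb distrC => /ltr_normlW Gx; exfalso.
have [Gxb|bGx|Gxb] := ltgtP (G x) b.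
- apply: (no_climb G b x) => //; first lra.
  by move=> y ?; apply: bup; lra.
- have GGx : G (G x) = G x by apply: (fixed_convex G b _ c) => //; lra.
  by have := periodic_landing 1 Px GGx; rewrite /=; have := bup x; lra.
- have GGx : G (G x) = G x by rewrite Gxb.
  by have := periodic_landing 1 Px GGx; rewrite /=; lra.
Qed.

Lemma unique_fixed G w : tame G -> 0 <= w <= 1 -> G w != w ->
  exists2 b, G b = b & forall c, G c = c -> c = b.
Proof.
move=> tG w01; rewrite neq_lt => /orP[Gw|wG]; last exact: unique_fixed_up wG.
have [||b Gb uniq] := @unique_fixed_up (mirror G) (1 - w) (tame_mirror _ tG).
- lra.
- by rewrite mirrorE; lra.
exists (1 - b); first by move: Gb; rewrite /mirror; lra.
move=> c Gcc; have := uniq (1 - c); rewrite mirrorE Gcc => /(_ erefl); lra.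
Qed.

Lemma alternating_left G b p : tame G -> G b = b ->
  (forall c, G c = c -> c = b) -> periodic_points G p -> p < b -> b < G p.
Proof.
move=> tG Gb uniq Pp pb; have Gc := tame_continuous _ tG.
have p01 : 0 <= p.
  case: Pp => m m0 <-; rewrite -(prednK m0) iterS.
  by have := tame_unit _ tG (iter m.-1 G p); lra.
rewrite ltNge; apply/negP; rewrite le_eqVlt => /orP[/eqP Gp|Gp].
  have := periodic_landing 1 Pp; rewrite /= Gp => /(_ Gb); lra.
apply: (no_climb G b p) => // y yb; rewrite ltNge; apply/negP => Gy.
have [||c c1 Gcc] := @fixed_between G 0 y Gc; first lra.
  by left; have := tame_unit _ tG 0; lra.
by have := uniq c Gcc; lra.
Qed.

Lemma alternating G b p : tame G -> G b = b ->
  (forall c, G c = c -> c = b) -> periodic_points G p -> p != b ->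
  (p - b) * (G p - b) < 0.
Proof.
move=> tG Gb uniq Pp; rewrite neq_lt => /orP[pb|bp].
  by have := alternating_left G b p tG Gb uniq Pp pb; nra.
have := alternating_left (mirror G) (1 - b) (1 - p) (tame_mirror _ tG).
rewrite !mirrorE Gb; have -> : 1 - b < 1 - G p = (G p < b) by lra.
move=> H; have : G p < b; last by nra.
apply: H => //; last lra.
- move=> c Gcc; have := uniq (1 - c); move: Gcc; rewrite /mirror => Gcc.
  by move=> /(_ ltac:(lra)); lra.
- by apply/periodic_mirror; rewrite subKr.
Qed.

Lemma one_sided_of_no_horseshoe F : continuous F ->
  (forall n, (0 < n)%N -> ~ horseshoe (iter n F)) -> one_sided F.
Proof.
move=> Fc noH b z s Fb Pz same; rewrite leNgt; apply/negP => opp.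
by have [n n0] := horseshoe_of_nonalternating _ _ _ _ Fc Fb Pz same opp;
  exact: noH.
Qed.

Lemma periodic_iter {T : Type} {F : T -> T} {x : T} k :
  periodic_points F x -> periodic_points (iter k F) x.
Proof.
by move=> [m m0 Fx]; exists m => //; rewrite -iterM mulnC iter_periodic.
Qed.

(** Without horseshoes both [F] and [G = F \o F] are one-sided.  The unique
fixed point [b] of [G] is fixed by [F], and a periodic [p] has [p] and [G p] on
opposite sides of [b].  So either [p], [F p] or [F p], [G p] lie on one side of
[b], and one-sidedness of [F] forbids the orbit to cross [b]. *)
Lemma horseshoe_of_dense_periodic F w : continuous F ->
  (forall x, 0 <= F x <= 1) -> dense_in_unit (periodic_points F) ->
  0 <= w <= 1 -> F (F w) != w ->
  exists2 n, (0 < n)%N & horseshoe (iter n F).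
Proof.
move=> Fc F01 Fd w01 FFw; apply: contrapT => noH.
have {}noH n : (0 < n)%N -> ~ horseshoe (iter n F).
  by move=> ? ?; apply: noH; exists n.
pose G := iter 2 F.
have tG : tame G.
  split.
  - exact: iter_continuous.
  - by move=> x; exact: F01.
  - move=> u v u0 uv v1; have [x uxv Px] := Fd u v u0 uv v1.
    by exists x => //; exact: periodic_iter.
  - apply: one_sided_of_no_horseshoe; first exact: iter_continuous.
    move=> n n0; rewrite (_ : iter n G = iter (n * 2) F); last first.
      by apply/funext => x; rewrite iterM.
    by apply: noH; rewrite muln_gt0 n0.
have [b Gb uniq] := unique_fixed G w tG w01 FFw.
have Fb : F b = b.
  have [||c c01 Fcc] := @fixed_between F 0 1 Fc; first lra.
    by left; have := F01 0; have := F01 1; lra.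
  by rewrite -(uniq c) // /G /= !Fcc.
have [p [Pp pb]] : exists p, periodic_points F p /\ p != b.
  have [b1|b1] := ltP b 1.
    have b0 : 0 <= b by have := F01 b; rewrite Fb; lra.
    have [||//|p pb Pp] := Fd b 1; try lra.
    by exists p; split => //; rewrite neq_lt; lra.
  have [||//|p pb Pp] := Fd 0 1; try lra.
  by exists p; split => //; rewrite neq_lt; lra.
have Fs := one_sided_of_no_horseshoe F Fc noH.
have alt := alternating G b p tG Gb uniq (periodic_iter 2 Pp) pb.
have same : 0 < (F p - b) * (F (F p) - b).
  have Fpb : F p != b.
    apply/eqP => e; have := periodic_landing 1 Pp; rewrite /= e => /(_ Fb).
    by move=> e'; rewrite e' eqxx in pb.
  have [pF|pF|/eqP] := ltgtP ((p - b) * (F p - b)) 0.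
  - exact: mul_gt0_opp_sign pF alt.
  - by have := Fs b p 2 Fb Pp pF; move: alt; rewrite /G /= => ? ?; lra.
  - by rewrite mulf_eq0 !subr_eq0 (negbTE pb) (negbTE Fpb).
have PFp : periodic_points F (F p).
  by case: Pp => m m0 Fm; exists m => //; rewrite -iterSr iterS Fm.
case: (Pp) => m m0 Fm.
have := Fs b (F p) m.-1 Fb PFp same; rewrite -iterSr prednK // Fm.
rewrite leNgt (@mul_lt0_same_sign _ (G p - b)) // mulrC //.
Qed.

End dense_periodic.

(** * Coding a horseshoe by 0-1 sequences *)

Section tighten.
Context {R : realType}.
Implicit Types (G : R -> R) (I J : R * R).

Definition itv I : set R := `[I.1, I.2].

(** Among the pairs [(s, t)] in [itv I] with [G s] and [G t] the ends of [J],
take one at minimal distance: a value of [G] outside [itv J] between [s] and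
[t] would yield, by the intermediate value theorem, a closer pair. *)
Lemma tight_subinterval G I J : continuous G -> J.1 <= J.2 ->
  itv J `<=` G @` itv I ->
  exists I', [/\ I'.1 <= I'.2, itv I' `<=` itv I & G @` itv I' = itv J].
Proof.
move=> Gc; case: J => c d /= cd cover.
pose level v := itv I `&` G @^-1` [set v].
have level_compact v : compact (level v).
  apply: compact_closedI; first exact: segment_compact.
  by apply: closed_comp; [move=> x _; exact: Gc | exact: closed_eq].
have [s0 Is0 Gs0] : (G @` itv I) c.
  by apply: cover; rewrite /itv /= in_itv /=; lra.
have [t0 It0 Gt0] : (G @` itv I) d.
  by apply: cover; rewrite /itv /= in_itv /=; lra.
have K0 : level c `*` level d !=set0 by exists (s0, t0).
have dist_cont : continuous (fun p : R * R => `|p.1 - p.2|).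
  by move=> p; apply: cvg_norm; apply: cvgB; [exact: cvg_fst | exact: cvg_snd].
have [[s t] /set_mem[/= [Is Gs] [It Gt]] st_min] :=
  compact_EVT_min K0 (compact_setX (level_compact c) (level_compact d))
    (continuous_subspaceT dist_cont).
have sub u v : itv I u -> itv I v -> seg u v `<=` itv I.
  by rewrite /itv /seg => + + y; rewrite /= !in_itv /=; lra.
exists (Num.min s t, Num.max s t).
have min_max : itv (Num.min s t, Num.max s t) = seg s t.
  apply/seteqP; split; last exact: seg_minmax.
  by move=> y; rewrite /itv /seg /= in_itv /=; case: (leP s t) => *; lra.
split; rewrite ?min_max /=.
- by rewrite ge_min le_max lexx.
- exact: sub.
apply/seteqP; split => [_ [y sty <-]|]; last first.
  apply: subset_trans (seg_image _ _ _ Gc); rewrite Gs Gt => y.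
  by rewrite /itv /seg /= in_itv /= => ->.
have Iy := sub _ _ Is It _ sty.
rewrite /itv /= in_itv /= !leNgt; apply/andP; split; apply/negP => Gy.
- have [|u yut Gu] := seg_image G y t Gc c; first by rewrite /seg /= Gt; lra.
  have : (u, t) \in level c `*` level d.
    by apply/mem_set; split => //=; split => //; exact: sub yut.
  move=> /st_min /= stu; have {}stu : u = y.
    move: sty yut stu; rewrite /seg /= => sty yut.
    by do 2 case: ler0P => ?; lra.
  by move: Gy; rewrite -stu Gu ltxx.
- have [|u suy Gu] := seg_image G s y Gc d; first by rewrite /seg /= Gs; lra.
  have : (s, u) \in level c `*` level d.
    by apply/mem_set; split => //=; split => //; exact: sub suy.
  move=> /st_min /= stu; have {}stu : u = y.
    move: sty suy stu; rewrite /seg /= => sty suy.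
    by do 2 case: ler0P => ?; lra.
  by move: Gy; rewrite -stu Gu ltxx.
Qed.

Definition tighten G I J : R * R := xget I [set I' |
  [/\ I'.1 <= I'.2, itv I' `<=` itv I & G @` itv I' = itv J]].

Lemma tightenP {G I J} : continuous G -> J.1 <= J.2 ->
  itv J `<=` G @` itv I ->
  [/\ (tighten G I J).1 <= (tighten G I J).2, itv (tighten G I J) `<=` itv I &
      G @` itv (tighten G I J) = itv J].
Proof.
move=> Gc J12 IJ; have [I' HI'] := tight_subinterval G I J Gc J12 IJ.
by rewrite /tighten; case: xgetP => [I'' _ //|/(_ I')]; case.
Qed.

End tighten.

Lemma nested_compact {T : topologicalType} (K : nat -> set T) :
  hausdorff_space T -> (forall k, compact (K k)) -> (forall k, K k !=set0) ->
  (forall k, K k.+1 `<=` K k) -> \bigcap_k K k !=set0.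
Proof.
move=> hT Kc K0 Kd.
have Kanti j k : (j <= k)%N -> K k `<=` K j.
  elim: k => [|k IHk]; first by rewrite leqn0 => /eqP ->.
  by rewrite leq_eqVlt => /orP[/eqP ->//|/IHk]; exact: subset_trans.
have [u Ku] := choice K0.
have ev k : \forall n \near \oo, K k (u n).
  by exists k => // n /= kn; exact: Kanti (Ku n).
have [x [_ clx]] := Kc 0%N (u @ \oo) _ (ev 0%N).
(* a cluster point of a choice of one point in each set *)
exists x => k _; apply: (compact_closed hT (Kc k)).
by move: clx; rewrite clusterE; apply; exact: ev.
Qed.

Definition shift (w : nat -> bool) : nat -> bool := fun i => w i.+1.

Definition prepend (s : bool) (w : nat -> bool) : nat -> bool :=
  fun i => if i is j.+1 then w j else s.

Lemma iter_shiftE j w i : iter j shift w i = w (j + i)%N.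
Proof. by elim: j i => //= j IHj i; rewrite /shift IHj addnS. Qed.

Lemma cantor_prefix_nbhs (w : cantor_space) k :
  \forall w' \near w, forall j, (j <= k)%N -> w' j = w j.
Proof.
have coord j : \forall w' \near w, w' j = w j.
  exact: (@proj_continuous nat (fun=> bool) j w [set w j] (discrete_set1 _)).
elim: k => [|k IHk].
  by apply: filterS (coord 0%N) => w' w0 j; rewrite leqn0 => /eqP ->.
apply: filterS2 IHk (coord k.+1) => w' wk wk1 j.
by rewrite leq_eqVlt => /orP[/eqP ->|/wk].
Qed.

Section coding.
Context {R : realType} {G : R -> R} (I0 I1 : R * R).
Hypotheses (G_cont : continuous G).
Hypotheses (I0_le : I0.1 <= I0.2) (I01 : I0.2 < I1.1) (I1_le : I1.1 <= I1.2).
Hypothesis I0_covers : itv (I0.1, I1.2) `<=` G @` itv I0.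
Hypothesis I1_covers : itv (I0.1, I1.2) `<=` G @` itv I1.
Implicit Types (w : nat -> bool) (x y : R).

(** Shrinking the cylinder of [w] so that it maps onto that of [shift w],
rather than intersecting preimages, keeps all cylinders segments. *)
Fixpoint cylinder k w : R * R :=
  if k is k'.+1 then tighten G (cylinder k' w) (cylinder k' (shift w))
  else if w 0%N then I1 else I0.

(** The covering of each cylinder over the next is the invariant that makes
[tighten] meaningful at every level. *)
Lemma cylinderP k w :
  (cylinder k w).1 <= (cylinder k w).2 /\
  itv (cylinder k (shift w)) `<=` G @` itv (cylinder k w).
Proof.
elim: k w => [|k IHk] w /=.
  split; first by case: ifP.
  have : itv (if shift w 0%N then I1 else I0) `<=` itv (I0.1, I1.2).
    move: I0_le I01 I1_le; case: ifP => _ ? ? ? t;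
      by rewrite /itv /= !in_itv /=; lra.
  by move=> /subset_trans; apply; case: ifP.
have [_ cov] := IHk w; have [val' cov'] := IHk (shift w).
have [? ? ->] := tightenP G_cont val' cov; split => //.
by have [] := tightenP G_cont (IHk (shift (shift w))).1 cov'.
Qed.

Lemma cylinder_nested k w : itv (cylinder k.+1 w) `<=` itv (cylinder k w).
Proof.
by have [] := tightenP G_cont (cylinderP k (shift w)).1 (cylinderP k w).2.
Qed.

Lemma cylinder_image k w :
  G @` itv (cylinder k.+1 w) = itv (cylinder k (shift w)).
Proof.
by have [] := tightenP G_cont (cylinderP k (shift w)).1 (cylinderP k w).2.
Qed.

Lemma cylinder_prefix k w w' :
  (forall j, (j <= k)%N -> w j = w' j) -> cylinder k w = cylinder k w'.
Proof.
elim: k w w' => [|k IHk] w w' ww' /=; first by rewrite ww'.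
by congr tighten; apply: IHk => j jk; apply: ww'; rewrite // ltnW.
Qed.

Definition fiber w : set R := \bigcap_k itv (cylinder k w).

Lemma fiber_nonempty w : fiber w !=set0.
Proof.
apply: nested_compact => [|k|k|k]; [exact: Rhausdorff|exact: segment_compact|
  |exact: cylinder_nested].
by exists (cylinder k w).1; rewrite /itv /= in_itv /= lexx (cylinderP k w).1.
Qed.

(** The inclusion from right to left is compactness: the preimages of a point
in the successive cylinders are nested and nonempty. *)
Lemma fiber_image w : G @` fiber w = fiber (shift w).
Proof.
apply/seteqP; split => [_ [x fx <-] k _|y fy].
  by rewrite -cylinder_image; exists x => //; exact: fx.
have [||||x fx] := @nested_compact _
    (fun k => itv (cylinder k.+1 w) `&` G @^-1` [set y]).
- exact: Rhausdorff.
- move=> k; apply: compact_closedI; first exact: segment_compact.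
  by apply: closed_comp; [move=> x _; exact: G_cont | exact: closed_eq].
- move=> k; have := fy k I; rewrite -cylinder_image => -[x ? ?].
  by exists x.
- by move=> k x [/cylinder_nested ? ?].
exists x; last by have [] := fx 0%N I.
by move=> k _; apply: cylinder_nested; have [] := fx k I.
Qed.

Lemma fiber_iter n w x : fiber w x -> fiber (iter n shift w) (iter n G x).
Proof.
elim: n => // n IHn fx; rewrite !iterS -fiber_image.
by exists (iter n G x) => //; exact: IHn.
Qed.

Lemma fiber_itinerary w w' x : fiber w x -> fiber w' x -> w = w'.
Proof.
move=> fx fx'; apply/funext => n.
have := fiber_iter n w x fx 0%N I; have := fiber_iter n w' x fx' 0%N I.
move: I01; rewrite /= !iter_shiftE addn0 /itv.
by case: (w n); case: (w' n) => //=; rewrite !in_itv /=; lra.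
Qed.

Lemma fiber_convex w x y t : fiber w x -> fiber w y -> x <= t <= y -> fiber w t.
Proof.
move=> fx fy xty k _; have := fx k I; have := fy k I.
by rewrite /itv /= !in_itv /=; lra.
Qed.

Hypothesis G_unit : forall x, 0 <= G x <= 1.
Hypothesis G_dense : dense_in_unit (periodic_points G).

(** Every fiber lies in the range of [G]. *)
Lemma fiber_unit w x : fiber w x -> 0 <= x <= 1.
Proof.
rewrite -[w]/(shift (prepend true w)) -fiber_image => -[y _ <-]; exact: G_unit.
Qed.

(** A nondegenerate fiber contains a periodic point by density, and the
itinerary of that point is periodic. *)
Lemma fiber_periodic w x y : fiber w x -> fiber w y -> x < y ->
  exists2 m, (0 < m)%N & forall k, w (k * m)%N = w 0%N.
Proof.
move=> fx fy xy.
have := fiber_unit _ _ fx; have := fiber_unit _ _ fy => y01 x01.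
have [|//||z xzy [m m0 Gz]] := G_dense x y; try lra.
have fz : fiber w z by apply: fiber_convex fx fy _; lra.
exists m => // k; have := fiber_iter (k * m) w z fz.
rewrite (iter_periodic k Gz) => fz'.
by rewrite [in RHS](fiber_itinerary _ _ _ fz fz') iter_shiftE addn0.
Qed.

(** A nondegenerate fiber of [w] makes the fibers of [prepend false w] and
[prepend true w] nondegenerate, as they are mapped onto it; both sequences are
then periodic, and at a common period of the two their first letters, which
differ, would both be equal to the same entry of [w]. *)
Lemma fiber_inj w x y : fiber w x -> fiber w y -> x = y.
Proof.
wlog xy : x y / x < y.
  by move=> H fx fy; have [?|?|//] := ltgtP x y; [|apply/esym]; apply: H.
move=> fx fy.
have periodic s : exists2 m, (0 < m)%N & forall k, prepend s w (k * m)%N = s.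
  have [x' fx' Gx'] : (G @` fiber (prepend s w)) x by rewrite fiber_image.
  have [y' fy' Gy'] : (G @` fiber (prepend s w)) y by rewrite fiber_image.
  have [xy'|xy'|xy'] := ltgtP x' y'.
  - exact: fiber_periodic fx' fy' xy'.
  - exact: fiber_periodic fy' fx' xy'.
  - by move: xy; rewrite -Gx' -Gy' xy' ltxx.
have [p p0 wp] := periodic false; have [q q0 wq] := periodic true.
(* entry [p * q] of both prepended sequences is entry [(p * q).-1] of [w] *)
have := wp q; have := wq p; rewrite mulnC.
by rewrite -(prednK (_ : 0 < q * p)%N) ?muln_gt0 ?q0 //= => ->.
Qed.

Definition code (w : cantor_space) : R := xget 0 (fiber w).

Lemma codeP w : fiber w (code w).
Proof. by have [x fx] := fiber_nonempty w; exact: xgetI fx. Qed.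

Lemma code_shift w : G (code w) = code (full_shift w).
Proof.
apply: (@fiber_inj (shift w)); last exact: codeP.
by rewrite -fiber_image; exists (code w) => //; exact: codeP.
Qed.

Lemma code_inj : injective code.
Proof.
move=> w w' ww'; apply: fiber_itinerary (codeP w) _.
by rewrite ww'; exact: codeP.
Qed.

Lemma code_unit w : 0 <= code w <= 1.
Proof. exact: fiber_unit (codeP w). Qed.

Lemma cylinder_small w e : 0 < e ->
  exists k, itv (cylinder k w) `<=` [set x | `|code w - x| < e].
Proof.
move=> e0; apply: contrapT => /forallNP big.
have [||||x fx] := @nested_compact _
    (fun k => itv (cylinder k w) `&` [set x | e <= `|code w - x|]).
- exact: Rhausdorff.
- move=> k; apply: compact_closedI; first exact: segment_compact.
  apply: (@closed_comp _ _ (fun x => `|code w - x|) [set t | e <= t]).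
    by move=> x _; apply: cvg_norm; apply: cvgB; [exact: cvg_cst|exact: cvg_id].
  exact: closed_ge.
- move=> k; have /existsNP[x /not_implyP[wx /negP]] := big k.
  by rewrite -leNgt => ex; exists x.
- by move=> k x [/cylinder_nested].
have : x = code w by apply: fiber_inj (codeP w) => k _; have [] := fx k I.
by move=> xw; have [_] := fx 0%N I; rewrite /= xw subrr normr0; lra.
Qed.

Lemma code_continuous : continuous code.
Proof.
move=> w; apply/cvgrPdist_lt => e e0.
have [k wk] := cylinder_small w e e0.
near=> w'; apply: wk; rewrite (@cylinder_prefix _ _ w').
  exact: codeP.
move=> j jk; apply/esym; move: j jk; near: w'; exact: cantor_prefix_nbhs.
Unshelve. all: by end_near. Qed.

End coding.

(** * Embedded shifts and the extension of a map to the line *)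

(** The inverse of the embedding is continuous on its range because the
domain is compact: closed sets have closed images. *)
Lemma conjugate_of_embedding {T : topologicalType} (h : T -> T)
    (e : cantor_space -> T) :
  hausdorff_space T -> continuous e -> injective e ->
  (forall w, h (e w) = e (full_shift w)) ->
  exists (X : set T) (hX : invariant_set h X),
    closed X /\ topologically_conjugate (restrict_self hX) full_shift.
Proof.
move=> hT ec e_inj he; pose X := range e.
have closed_image A : closed A -> closed (e @` A).
  move=> Acl; apply: compact_closed hT _; apply: continuous_compact.
    exact: continuous_subspaceT.
  by apply: subclosed_compact Acl cantor_space_compact _.
have hX : invariant_set h X.
  by move=> _ [_ [w _ <-] <-]; rewrite he; exists (full_shift w).
have code_of (x : X) : {w | e w = \val x}.
  by apply: cid; have [w _ <-] := set_valP x; exists w.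
pose phi (x : X) : cantor_space := projT1 (code_of x).
have phiP x : e (phi x) = \val x by exact: (projT2 (code_of x)).
pose psi (w : cantor_space) : X := exist _ (e w) (mem_set (imageT e w)).
exists X, hX; split; first by apply: closed_image; exact: closedT.
exists phi; last first.
  by apply/funext => x; apply: e_inj; rewrite /= phiP /= -he phiP.
split.
  apply/continuous_closedP => A /closed_image cA.
  have -> : phi @^-1` A = \val @^-1` (e @` A).
    apply/seteqP; split => x /=; first by exists (phi x).
    by move=> [w Aw]; rewrite -phiP => /e_inj <-.
  by apply: closed_comp cA => x _; exact: initial_continuous.
exists psi; split.
- by move=> x; apply: val_inj; rewrite /= phiP.
- by move=> w; apply: e_inj; rewrite phiP.
- exact: continuous_comp_initial.
Qed.

Section extension.
Context {R : realType}.
Local Notation I := (unit_interval R).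

Definition clamp (x : R) : R := Num.max 0 (Num.min 1 x).

Lemma clamp_unit x : unit_interval R (clamp x).
Proof.
by rewrite /unit_interval /= in_itv /= /clamp le_max ge_max ge_min ler01 !lexx.
Qed.

Definition to_unit (x : R) : I := exist _ (clamp x) (mem_set (clamp_unit x)).

Lemma val_to_unit x : 0 <= x <= 1 -> \val (to_unit x) = x.
Proof. by move=> /andP[x0 x1] /=; rewrite /clamp min_r // max_r. Qed.

(** Hausdorffness pulls back along the injective continuous map [\val]. *)
Lemma unit_hausdorff : hausdorff_space I.
Proof.
move=> x y xy; apply: val_inj; apply: (@Rhausdorff R) => A B xA yB.
have [z [Az Bz]] : (\val @^-1` A : set I) `&` \val @^-1` B !=set0.
  by apply: xy; [exact: (@initial_continuous _ _ _ x A xA)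
    | exact: (@initial_continuous _ _ _ y B yB)].
by exists (\val z).
Qed.

Lemma to_unitK (x : I) : to_unit (\val x) = x.
Proof. by apply: val_inj; rewrite val_to_unit // unit_val01. Qed.

Lemma clamp_continuous : continuous clamp.
Proof.
move=> x; apply: (@continuous_max R R (fun=> 0) (fun x => Num.min 1 x)).
  exact: cvg_cst.
apply: (@continuous_min R R (fun=> 1) id); [exact: cvg_cst | exact: cvg_id].
Qed.

Lemma to_unit_continuous : continuous to_unit.
Proof. by apply: continuous_comp_initial; exact: clamp_continuous. Qed.

Variable f : I -> I.

(** Extending [f] to the whole line lets one iterate it and apply the
intermediate value theorem to it without leaving the real functions. *)
Definition extend (x : R) : R := \val (f (to_unit x)).

Lemma extend_continuous : continuous f -> continuous extend.
Proof.
move=> fc x; apply: (@continuous_comp _ _ _ to_unit (\val \o f)).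
  exact: to_unit_continuous.
by apply: continuous_comp; [exact: fc | exact: initial_continuous].
Qed.

Lemma extend_unit x : 0 <= extend x <= 1.
Proof. exact: unit_val01. Qed.

Lemma iter_extend n (x : I) : iter n extend (\val x) = \val (iter n f x).
Proof. by elim: n => //= n ->; rewrite /extend to_unitK. Qed.

Lemma extend_dense : dense (periodic_points f) ->
  dense_in_unit (periodic_points extend).
Proof.
move=> fd u v u0 uv v1; pose O : set I := \val @^-1` `]u, v[.
have O0 : O !=set0.
  exists (to_unit ((u + v) / 2)).
  suff : u < \val (to_unit ((u + v) / 2)) < v by rewrite /O /= in_itv.
  by rewrite val_to_unit; lra.
have Oo : open O.
  by apply: open_comp; [move=> x _; exact: initial_continuous|exact: itv_open].
have [x [Ox [m m0 fx]]] := fd O O0 Oo.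
exists (\val x); first by move: Ox; rewrite /O /= in_itv.
by exists m => //; rewrite iter_extend fx.
Qed.

End extension.

(** * The embedded full shift *)

Theorem corollary1p7 (R : realType) (f : unit_interval R -> unit_interval R) :
  continuous f ->
  (0 < topological_entropy f)%E ->
  dense (periodic_points f) ->
  exists (n : nat) (X : set (unit_interval R))
         (fnX : invariant_set (iter n f) X),
    [/\ (0 < n)%N, closed X
      & topologically_conjugate (restrict_self fnX) full_shift].
Proof.
move=> fc ent fd; pose F := extend f.
have Fc : continuous F := extend_continuous f fc.
have Fd : dense_in_unit (periodic_points F) := extend_dense f fd.
have [w ffw] : exists w, f (f w) <> w.
  apply: contrapT => /forallNP ff; move: ent; rewrite ltNge => /negP; apply.
  by apply: entropy_involution => x; exact: contrapT (ff x).
have [||n n0 [a0 [b0 [a1 [b1 [ab0 ba ab1 cov0 cov1]]]]]] :=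
  horseshoe_of_dense_periodic F (\val w) Fc (extend_unit f) Fd.
- exact: unit_val01.
- apply/eqP => FFw; apply: ffw; apply: val_inj.
  by rewrite -[RHS]FFw; exact/esym/(iter_extend f 2).
pose G := iter n F.
have Gc : continuous G := iter_continuous n Fc.
have G01 x : 0 <= G x <= 1.
  by rewrite /G -(prednK n0) iterS; exact: extend_unit.
have Gd : dense_in_unit (periodic_points G).
  move=> u v u0 uv v1; have [x uxv Px] := Fd u v u0 uv v1.
  by exists x => //; exact: periodic_iter.
pose c := @code _ G (a0, b0) (a1, b1).
have c01 w' : 0 <= c w' <= 1 by exact: code_unit.
pose e (w' : cantor_space) : unit_interval R := to_unit (c w').
have [||||X [fnX [Xc conj]]] :=
  @conjugate_of_embedding _ (iter n f) e.
- exact: unit_hausdorff.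
- move=> w'; apply: (@continuous_comp _ _ _ c to_unit).
    exact: code_continuous.
  exact: to_unit_continuous.
- move=> w1 w2 /(congr1 \val); rewrite !val_to_unit //; exact: code_inj.
- move=> w'; apply: val_inj; rewrite -iter_extend !val_to_unit //.
  exact: code_shift.
by exists n, X, fnX.
Qed.
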